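(* Let $G$ be a countable group. A countable $G$-set $X$ admits a moderate $\ell^1$-function if and only if it has subexponential growth of orbits.
   Context: A $G$-set is a set with an action of $G$. For a function $f\colon X\to\mathbb{R}$ on a set $X$, $\lim_{x\to\infty}f(x)=l$ means that $f(x)$ tends to $l$ as $x$ escapes from finite subsets of $X$: for every $\varepsilon>0$ there is a finite set $K\subset X$ such that $|f(x)-l|<\varepsilon$ for all $x\in X\setminus K$. A moderate $\ell^1$-function on a $G$-set $X$ is a function $\nu\in\ell^1(X)$ such that $\nu(x)>0$ for every $x\in X$ and, for every $g\in G$, $\lim_{x\to\infty}\nu(gx)/\nu(x)=1$. A $G$-set $X$ has subexponential growth of orbits if for every nonempty finite subset $S\subset G$ and every $x\in X$, $\lim_{n\to\infty}|S^nx|^{1/n}=1$, where $S^nx=\{s_1\cdots s_nx: s_j\in S\}$ (no uniformity in $S$ or $x$ is required). *)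

(* Defs.v *)
From HB Require Import structures.
From mathcomp Require Import all_boot all_order all_algebra all_fingroup finmap.
From mathcomp Require Import all_classical all_reals all_analysis.

Set Implicit Arguments.
Unset Strict Implicit.
Unset Printing Implicit Defensive.

Import Order.TTheory GRing.Theory Num.Theory.
Import numFieldNormedType.Exports.

Local Open Scope classical_set_scope.
Local Open Scope ring_scope.

(* MathComp's [action] is restricted to finite groups and acts on the right;
   this is a left action of a possibly infinite group. *)
Record gset_action (G : groupType) (X : Type) := GSetAction {
  gact :> G -> X -> X;
  gact1 : forall x, gact 1%g x = x;
  gactM : forall g h x, gact (g * h)%g x = gact g (gact h x)
}.

(* The cofinite filter is improper when X is finite; the limit condition is
   then vacuous, as it should be. *)
Definition moderate_l1 (R : realType) (G : groupType) (X : choiceType)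
    (a : gset_action G X) (nu : X -> R) : Prop :=
  [/\ summable [set: X] (fun x => (nu x)%:E),
      forall x, 0 < nu x &
      forall g, nu (a g x) / nu x
        @[x --> (@frechet_filter X : set_system X)] --> (1 : R)].

(* S^n x = { s_1 ... s_n x : s_j in S } *)
Definition set_orbit (G : groupType) (X : Type) (a : gset_action G X)
    (S : set G) (n : nat) (x : X) : set X :=
  [set y | exists2 s : 'I_n -> G,
     forall j, S (s j) & y = a (\prod_(j < n) s j)%g x].

(* [fset_set A] lists the elements of A when A is finite, and [set_orbit] is
   finite whenever S is.  The term n = 0 of the sequence has the junk exponent
   0^-1 = 0, which is irrelevant to the limit. *)
Definition subexponential_orbits (R : realType) (G : groupType)
    (X : choiceType) (a : gset_action G X) : Prop :=
  forall (S : set G) (x : X), finite_set S -> S !=set0 ->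
    ((#|` fset_set (set_orbit a S n x)|%fset)%:R `^ (n%:R^-1))
      @[n --> \oo] --> (1 : R).

(* Main.v *)
Require Import Defs.
From mathcomp Require Import all_boot all_order all_algebra all_fingroup finmap.
From mathcomp Require Import all_classical all_reals all_analysis.
From mathcomp Require Import ring lra zify.

Local Open Scope classical_set_scope.
Local Open Scope ring_scope.

(** A moderate function nu decays slower than any given exponential along
    orbits. Fix a finite set S and q < 1. Outside a finite set K one has
    nu (s y) >= q * nu y for all s in S; if C > 0 is a lower bound of nu on x and
    on S K, an induction that restarts at each visit of K gives
    nu y >= C * q ^ n on S^n x. Summing over S^n x,
    |S^n x| <= (||nu||_1 / C) * q ^ -n, and q can be taken arbitrarily close to 1
    ([moderate_l1_subexponential]).

    Conversely, exhaust G and X by increasing finite sets S_k, containing 1, and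
    F_k. For fixed k the orbits S_k^n x with x in F_k eventually have at most
    (1 + 1/(k+1)) ^ n elements, so a diagonal argument ([diagonal_index]) yields
    k = k(n), nondecreasing, unbounded and at most n, for which this bound holds
    at every n. The finite sets B_n = S_{k(n)}^n F_{k(n)} then increase to X, a
    given g maps B_n into B_{n+1} for all large n, and |B_n| is at most
    n * (1 + 1/(k(n)+1)) ^ n. Let rho y be the least n with y in B_n: away from a
    finite set, g changes rho by at most 1. The weights
    v n = (n+1)^-3 * prod_(i < n) (1 + 1/(k(i)+1))^-1 satisfy
    v (n+1) / v n --> 1 because k(n) tends to infinity, and
    v n * |B_n| <= 1 / ((n+1) * (n+2)) because k is nondecreasing. Hence v o rho
    is summable and moderate ([exhaustion_moderate_l1]). *)

Set Implicit Arguments.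
Unset Strict Implicit.
Import Order.TTheory GRing.Theory Num.Theory.
Import numFieldNormedType.Exports.

(** * Growth rates and limits *)

Lemma near_expr_ge (R : realType) (c M : R) :
  1 < c -> \forall n \near \oo, M <= c ^+ n.
Proof.
move=> c1; have c0 : 0 < c by lra.
have M0 : 0 < `|M| + 1 by have := normr_ge0 M; lra.
have : `|c^-1| < 1 by rewrite gtr0_norm ?invr_gt0// invf_lt1.
move/cvg_expr/cvgr0Pnorm_lt => /(_ (`|M| + 1)^-1); rewrite invr_gt0 => /(_ M0).
apply: filterS => n.
rewrite exprVn ger0_norm; last by rewrite invr_ge0 exprn_ge0// ltW.
rewrite ltf_pV2 ?posrE ?exprn_gt0//.
by have := ler_norm M; lra.
Qed.

(** Both implications of the main equivalence use subexponential growth in this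
    form, which mentions no real exponents. *)
Lemma cvg_root_natP (R : realType) (b : nat -> nat) : (forall n, (0 < b n)%N) ->
  ((b n)%:R `^ (n%:R^-1) @[n --> \oo] --> (1 : R)) <->
  (forall c : R, 1 < c -> \forall n \near \oo, (b n)%:R <= c ^+ n).
Proof.
move=> b0; split=> [/cvgrPdist_lt cv c c1|bc].
  have c10 : 0 < c - 1 by lra.
  near=> n.
  have n0 : n%:R != 0 :> R by rewrite pnatr_eq0 -lt0n; near: n; exact: nbhs_infty_gt.
  have uc : (b n)%:R `^ (n%:R^-1) < c.
    have : `|1 - (b n)%:R `^ (n%:R^-1)| < c - 1 by near: n; exact: cv.
    by rewrite distrC => /(le_lt_trans (ler_norm _)); lra.
  have -> : (b n)%:R = ((b n)%:R `^ (n%:R^-1)) ^+ n :> R.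
    by rewrite -powR_mulrn ?powR_ge0// -powRrM mulVf// powRr1.
  by rewrite lerXn2r ?nnegrE ?powR_ge0// ltW//; lra.
apply/cvgrPdist_lt => e e0; near=> n.
have n0 : n%:R != 0 :> R by rewrite pnatr_eq0 -lt0n; near: n; exact: nbhs_infty_gt.
have c0 : 0 <= 1 + e / 2 by lra.
have bn : (b n)%:R <= (1 + e / 2) ^+ n by near: n; apply: bc; lra.
have u1 : 1 <= (b n)%:R `^ (n%:R^-1) :> R.
  have := @ge0_ler_powR R n%:R^-1 _ 1 (b n)%:R.
  by rewrite powR1 => -> //; rewrite ?invr_ge0 ?nnegrE ?ler1n.
have u2 : (b n)%:R `^ (n%:R^-1) <= 1 + e / 2.
  have -> : 1 + e / 2 = ((1 + e / 2) ^+ n) `^ (n%:R^-1).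
    by rewrite -powR_mulrn// -powRrM mulfV// powRr1.
  by apply: ge0_ler_powR bn; rewrite ?invr_ge0 ?nnegrE ?exprn_ge0.
by rewrite distrC ger0_norm; lra.
Unshelve. all: by end_near.
Qed.

(** Convergence along the cofinite filter, also when X is finite and the filter
    improper. *)
Lemma cvg_cofiniteP (R : realType) (X : Type) (f : X -> R) (l : R) :
  f x @[x --> (@frechet_filter X : set_system X)] --> l <->
  (forall e, 0 < e -> finite_set [set x | e <= `|l - f x|]).
Proof.
split=> [cv e e0|fin A /nbhs_ballP[e /= e0 eA]].
  have /cv : nbhs l (ball l e) by apply: (nbhsx_ballx l e e0).
  rewrite /= /frechet_filter /=; apply: sub_finite_set => x /=.
  by rewrite /ball/= => le; apply/negP; rewrite -leNgt.
rewrite /= /frechet_filter /=; apply: sub_finite_set (fin e e0) => x /=.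
move=> nA; rewrite leNgt; apply/negP => lt; exact/nA/eA.
Qed.

(** If each row of P eventually holds, and row 0 always does, then P holds along
    some index k(n) that tends to infinity as slowly as the rows require. *)
Lemma diagonal_index (P : nat -> nat -> Prop) :
  (forall n, P 0 n) -> (forall k, \forall n \near \oo, P k n) ->
  exists k : nat -> nat, [/\ (forall n, P (k n) n), (forall n, (k n <= n)%N),
    {homo k : m n / (m <= n)%N} & forall K, exists n, (K <= k n)%N].
Proof.
move=> P0 PN.
(* k increases by 1 at n as soon as row (k n).+1 holds from n on. *)
pose Q k n := forall m, (n <= m)%N -> P k m.
pose k := fix k n := if n is n'.+1 then
  (if `[< Q (k n').+1 n >] then (k n').+1 else k n') else 0%N.
have kS n : k n.+1 = if `[< Q (k n).+1 n.+1 >] then (k n).+1 else k n by [].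
have Qk n : Q (k n) n.
  elim: n => [m _//|n IH]; rewrite kS; case: asboolP => // _ m nm.
  by apply: IH; exact: ltnW.
have kmono : {homo k : m n / (m <= n)%N}.
  apply: homo_leq => // [m n p|n]; first exact: leq_trans.
  by rewrite kS; case: asboolP.
exists k; split=> //.
- by move=> n; exact: Qk.
- by elim=> // n IH; rewrite kS; case: asboolP => // _; exact: leqW.
elim=> [|K [n Kn]]; first by exists 0%N.
have [M _ PM] := PN K.+1.
have := leq_trans Kn (kmono _ _ (leq_maxl n M)).
rewrite leq_eqVlt => /predU1P[Kk|]; last by exists (maxn n M).
exists (maxn n M).+1; rewrite kS; case: asboolP => [_|[]]; first by rewrite -Kk.
rewrite -Kk => m mM; apply: PM => /=.
by apply: leq_trans (ltnW mM); exact: leq_maxr.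
Qed.

(** * Positive functions: lower bounds and summability *)

Lemma pos_lower_bound (R : realType) (X : Type) (nu : X -> R) (A : set X) :
  (forall x, 0 < nu x) -> finite_set A ->
  exists2 C : R, 0 < C & forall x, A x -> C <= nu x.
Proof.
move=> nu0 /(@finite_image _ _ _ nu)/finite_seqP[s sE].
have s0 y : y \in s -> 0 < y.
  by move=> ys; have : [set` s] y by []; rewrite -sE => -[x _ <-].
have [C C0 CP] : exists2 C : R, 0 < C & forall y, y \in s -> C <= y.
  elim: s s0 {sE} => [_|z s IH zs]; first by exists 1.
  have [y ys|C C0 CP] := IH; first by apply: zs; rewrite inE ys orbT.
  have z0 : 0 < z by apply: zs; rewrite inE eqxx.
  exists (Num.min z C); first by rewrite lt_min z0.
  move=> y; rewrite inE => /predU1P[->|/CP Cy]; rewrite ge_min ?lexx//.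
  by rewrite Cy orbT.
by exists C => // x Ax; apply: CP; have : [set` s] (nu x) by rewrite -sE; exists x.
Qed.

Lemma summable_posP (R : realType) (X : choiceType) (nu : X -> R) :
  (forall x, 0 < nu x) -> summable [set: X] (fun x => (nu x)%:E) <->
  exists M : R, forall A : set X, finite_set A -> \sum_(x <- fset_set A) nu x <= M.
Proof.
move=> nu0.
have sumE A : finite_set A -> (\sum_(x \in A) `|(nu x)%:E|)%E =
    ((\sum_(x <- fset_set A) nu x)%:E)%E.
  move=> Af; rewrite fsbig_finite//= -sumEFin.
  by apply: eq_bigr => x _; rewrite gtr0_norm.
split=> [sm|[M bM]].
  have fn : (\esum_(x in [set: X]) `|(nu x)%:E|)%E \is a fin_num.
    by rewrite -summableE.
  exists (fine (\esum_(x in [set: X]) `|(nu x)%:E|)%E) => A Af.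
  by rewrite -lee_fin fineK// -sumE//; apply: esum_ge; exists A.
rewrite /summable; apply: (@le_lt_trans _ _ M%:E); last exact: ltry.
apply: ge_ereal_sup => _ [A [Af _] <-].
by rewrite sumE// lee_fin; exact: bM.
Qed.

(** * Orbits of finite sets *)

Lemma set_orbit0 (G : groupType) (X : choiceType)
    (a : gset_action G X) (S : set G) (x : X) :
  set_orbit a S 0 x = [set x].
Proof.
apply/seteqP; split=> y /=; first by move=> [s _ ->]; rewrite big_ord0 Defs.gact1.
by move=> ->; exists (fun=> 1%g) => [[]//|]; rewrite big_ord0 Defs.gact1.
Qed.

Lemma set_orbitS (G : groupType) (X : choiceType)
    (a : gset_action G X) (S : set G) n (x : X) :
  set_orbit a S n.+1 x = [set a s y | s in S & y in set_orbit a S n x].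
Proof.
apply/seteqP; split=> y /=.
  move=> [s Ss ->]; rewrite big_ord_recl Defs.gactM.
  exists (s ord0) => //.
  exists (a (\prod_(i < n) s (lift ord0 i))%g x) => //.
  by exists (s \o lift ord0) => // j /=.
move=> [g Sg [_ [s Ss ->] <-]].
exists (fun j => if unlift ord0 j is Some i then s i else g).
  by move=> j; case: unliftP.
rewrite big_ord_recl Defs.gactM unlift_none.
by under [in RHS]eq_bigr do rewrite liftK.
Qed.

Lemma finite_set_orbit (G : groupType) (X : choiceType)
    (a : gset_action G X) (S : set G) n (x : X) :
  finite_set S -> finite_set (set_orbit a S n x).
Proof.
move=> Sf; elim: n => [|n IH]; first by rewrite set_orbit0.
by rewrite set_orbitS; exact: finite_image2.
Qed.

Lemma card_set_orbit_gt0 (G : groupType) (X : choiceType)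
    (a : gset_action G X) (S : set G) n (x : X) :
  finite_set S -> S !=set0 ->
  (0 < #|` fset_set (set_orbit a S n x)|)%N.
Proof.
move=> Sf [g Sg]; rewrite cardfs_gt0; apply/fset0Pn.
exists (a (\prod_(j < n) g)%g x); rewrite in_fset_set; last exact: finite_set_orbit.
by rewrite inE; exists (fun=> g).
Qed.

Lemma sub_set_orbit (G : groupType) (X : choiceType)
    (a : gset_action G X) (S T : set G) n (x : X) :
  S `<=` T -> set_orbit a S n x `<=` set_orbit a T n x.
Proof. by move=> ST y [s Ss ->]; exists s => // j; exact/ST. Qed.

(** * From a moderate function to subexponential growth *)

Lemma moderate_l1_subexponential (R : realType) (G : groupType) (X : choiceType)
    (a : gset_action G X) (nu : X -> R) :
  moderate_l1 a nu -> subexponential_orbits R a.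
Proof.
move=> [sm nu0 lim] S x Sf S0.
apply/cvg_root_natP => [n|c c1]; first exact: card_set_orbit_gt0.
have [M bM] := (summable_posP nu0).1 sm.
(* The rate q is d^-1 with 1 < d < c, so that a constant times d ^ n is
   eventually at most c ^ n. *)
pose d := (1 + c) / 2.
have d1 : 1 < d by rewrite /d; lra.
have d0 : 0 < d by lra.
have dV : 0 < 1 - d^-1 by rewrite subr_gt0 invf_lt1.
pose K := \bigcup_(s in S) [set y | 1 - d^-1 <= `|1 - nu (a s y) / nu y|].
have Kf : finite_set K.
  by apply: bigcup_finite => // s _; exact: (cvg_cofiniteP _ _).1 (lim s) _ dV.
have [C C0 CP] : exists2 C : R, 0 < C &
    forall y, (x |` [set a s y | s in S & y in K]) y -> C <= nu y.
  apply: pos_lower_bound => //; rewrite finite_setU; split=> //.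
  exact: finite_image2.
(* If z lies in K, the bound at s z comes from C alone, not from z. *)
have low n y : set_orbit a S n x y -> C * d^-1 ^+ n <= nu y.
  elim: n y => [|n IH] y.
    by rewrite set_orbit0 => ->; rewrite mulr1; apply: CP; left.
  rewrite set_orbitS => -[s Ss [z /IH zn <-]].
  have [Kz|nKz] := pselect (K z).
    apply: (@le_trans _ _ C); last by apply: CP; right; exists s => //; exists z.
    by rewrite ler_piMr ?(ltW C0)// exprn_ile1 ?invr_ge0 ?(ltW d0)// invf_le1// ltW.
  have lt : `|1 - nu (a s z) / nu z| < 1 - d^-1.
    by rewrite ltNge; apply/negP => h; apply: nKz; exists s.
  have dz : d^-1 <= nu (a s z) / nu z.
    by have := le_lt_trans (ler_norm _) lt; lra.
  rewrite exprS mulrCA -(divfK (lt0r_neq0 (nu0 z)) (nu (a s z))).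
  by rewrite ler_pM// ?invr_ge0 ?ltW// mulr_gt0// exprn_gt0// invr_gt0.
near=> n.
set A := set_orbit a S n x.
have Af : finite_set A by exact: finite_set_orbit.
have cM : M / C <= (c / d) ^+ n.
  by near: n; apply: near_expr_ge; rewrite ltr_pdivlMr// mul1r /d; lra.
have : (C * d^-1 ^+ n) * (#|` fset_set A|)%:R <= M.
  apply: le_trans (bM A Af); rewrite mulr_natr.
  have -> : C * d^-1 ^+ n *+ #|` fset_set A| = \sum_(y <- fset_set A) (C * d^-1 ^+ n).
    by rewrite big_const_seq count_predT iter_addr_0.
  rewrite big_seq [leRHS]big_seq; apply: ler_sum => y.
  by rewrite in_fset_set// inE; exact: low.
rewrite -ler_pdivlMl ?mulr_gt0 ?exprn_gt0 ?invr_gt0// => /le_trans; apply.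
rewrite invfM exprVn invrK mulrAC [_ * M]mulrC.
rewrite -ler_pdivlMr ?exprn_gt0//.
by rewrite -expr_div_n.
Unshelve. all: by end_near.
Qed.

(** * Moderate functions from exhaustions *)

(** The elements of s at level n all lie in B n, so the sum grouped by levels is
    bounded by the sum of v n * |B n|. *)
Lemma sum_level_le (R : realType) (X : choiceType) (rho : X -> nat)
    (B : nat -> set X) (v : nat -> R) (M : R) (s : seq X) :
  (forall n, finite_set (B n)) -> (forall x, B (rho x) x) ->
  (forall n, 0 <= v n) ->
  (forall N, \sum_(n < N) v n * (#|` fset_set (B n)|)%:R <= M) ->
  uniq s -> \sum_(x <- s) v (rho x) <= M.
Proof.
move=> Bf Brho v0 vM us.
pose N := (\max_(x <- s) rho x).+1.
apply: le_trans (vM N).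
have -> : \sum_(x <- s) v (rho x) =
    \sum_(x <- s) \sum_(n < N) (if rho x == n then v n else 0).
  rewrite big_seq [RHS]big_seq; apply: eq_bigr => x xs.
  have xN : (rho x < N)%N by rewrite ltnS; exact: leq_bigmax_seq.
  rewrite (bigD1 (Ordinal xN))//= eqxx big1 ?addr0// => i; rewrite -val_eqE/= eq_sym.
  by move=> /negbTE ->.
rewrite exchange_big; apply: ler_sum => n _.
rewrite -big_mkcond big_const_seq iter_addr_0.
rewrite -[leLHS]mulr_natr ler_wpM2l // ler_nat -size_filter.
apply: uniq_leq_size; first exact: filter_uniq.
move=> x; rewrite mem_filter => /andP[/eqP <- _].
by rewrite in_fset_set// inE.
Qed.

(** A function constant on the layers of an exhaustion B is moderate when each
    group element moves points by at most one layer, up to finitely many layers,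
    and the weights of consecutive layers are asymptotically equal; the bound on
    the weighted cardinals makes it summable. *)
Lemma exhaustion_moderate_l1 (R : realType) (G : groupType) (X : choiceType)
    (a : gset_action G X) (B : nat -> set X) (v : nat -> R) (M : R) :
  (forall n, finite_set (B n)) -> {homo B : m n / (m <= n)%N >-> m `<=` n} ->
  (forall x, exists n, B n x) ->
  (forall g, exists N, forall n, (N <= n)%N ->
     forall x, B n x -> B n.+1 (a g x)) ->
  (forall n, 0 < v n) -> v n.+1 / v n @[n --> \oo] --> (1 : R) ->
  (forall N, \sum_(n < N) v n * (#|` fset_set (B n)|)%:R <= M) ->
  exists nu : X -> R, moderate_l1 a nu.
Proof.
move=> Bf Bmono Bcov Bstep v0 vlim vM.
have exB x : exists n, `[< B n x >] by have [n Bn] := Bcov x; exists n; exact/asboolP.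
pose rho x := ex_minn (exB x).
have Brho x : B (rho x) x by rewrite /rho; case: ex_minnP => n /asboolP.
have rho_le n x : B n x -> (rho x <= n)%N.
  by move=> Bn; rewrite /rho; case: ex_minnP => m _; apply; exact/asboolP.
have rho_step g : exists N, forall x, (rho (a g x) <= (maxn (rho x) N).+1)%N.
  have [N BN] := Bstep g; exists N => x; apply: rho_le.
  apply: BN; first exact: leq_maxr.
  by apply: Bmono (Brho x); exact: leq_maxl.
exists (fun x => v (rho x)); split=> [| |g] //.
  apply/summable_posP => //; exists M => A _.
  by apply: (sum_level_le Bf Brho _ vM (fset_uniq _)) => n; exact: ltW.
apply/cvg_cofiniteP => e e0.
have [N1 step1] := rho_step g.
have [N2 step2] := rho_step g^-1%g.
have [N3 _ P3] := (cvgrPdist_lt _ _).1 vlim e e0.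
have vlim' : v n / v n.+1 @[n --> \oo] --> (1 : R).
  have -> : (fun n => v n / v n.+1) = (fun n => (v n.+1 / v n)^-1).
    by apply/funext => n; rewrite invf_div.
  by rewrite -[X in _ --> X]invr1; apply: cvgV => //; exact: oner_neq0.
have [N4 _ P4] := (cvgrPdist_lt _ _).1 vlim' e e0.
apply: (sub_finite_set _ (Bf (N1 + N2 + N3 + N4).+1)) => x /= ex.
apply: Bmono (Brho x); rewrite leqNgt; apply/negP => xN.
(* As rho x exceeds N2 + 1, the bound rho x <= max (rho (g x)) N2 + 1 gives
   rho x <= rho (g x) + 1. *)
have := step1 x; have := step2 (a g x).
rewrite -Defs.gactM mulVg Defs.gact1.
move: xN ex; set n := rho x; set m := rho (a g x) => nN ex mn nm.
have : [|| m == n, m == n.+1 | n == m.+1] by lia.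
case/or3P => /eqP E; move: ex; apply/negP; rewrite -ltNge E.
- by rewrite divff ?subrr ?normr0// lt0r_neq0.
- by apply: P3 => /=; lia.
- by apply: P4 => /=; lia.
Qed.

(** Weights that beat the growth rate (1 + 1/(k(n)+1)) ^ n although their
    consecutive ratios tend to 1. The cube leaves room for a further factor n, as
    n / (n+1)^3 is still summable. *)
Lemma slow_weight (R : realType) (k : nat -> nat) :
  {homo k : m n / (m <= n)%N} -> (forall K, exists n, (K <= k n)%N) ->
  exists v : nat -> R, [/\ forall n, 0 < v n,
    v n.+1 / v n @[n --> \oo] --> (1 : R) &
    forall n, v n * (1 + (k n).+1%:R^-1) ^+ n <= (n.+1%:R ^+ 3)^-1].
Proof.
move=> kmono kinf.
pose q i : R := 1 + (k i).+1%:R^-1.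
have q0 i : 0 < q i by rewrite /q addr_gt0// invr_gt0.
pose v n : R := (n.+1%:R ^+ 3)^-1 / \prod_(i < n) q i.
have Q0 n : 0 < \prod_(i < n) q i by apply: prodr_gt0.
have kcvg : k n @[n --> \oo] --> \oo.
  move=> A [K _ KA]; have [n Kn] := kinf K; exists n => // m /= nm.
  by apply: KA => /=; apply: leq_trans (kmono _ _ nm).
have h : (k n).+1%:R^-1 @[n --> \oo] --> (0 : R).
  exact: (cvg_comp _ _ kcvg (@cvg_harmonic R)).
exists v; split=> [n||n].
- by rewrite /v divr_gt0// invr_gt0 exprn_gt0.
- pose r n : R := 1 - n.+2%:R^-1.
  have -> : (fun n => v n.+1 / v n) =
      (fun n => r n * (r n * r n) * (q n)^-1).
    apply/funext => n; rewrite /v /r big_ord_recr/=.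
    have := lt0r_neq0 (Q0 n); have := lt0r_neq0 (q0 n).
    set Q := \prod_(i < n) _ => qn Qn.
    have : (n.+1%:R : R) != 0 by rewrite pnatr_eq0.
    have : (n.+2%:R : R) != 0 by rewrite pnatr_eq0.
    have -> : (n.+1%:R : R) = n.+2%:R - 1 by rewrite -[n.+2]addn1 natrD addrK.
    by move: (n.+2%:R) => p p0 p1; field; rewrite p0 p1 qn Qn.
  have r1 : r n @[n --> \oo] --> (1 : R).
    rewrite -[X in _ --> X]subr0; apply: cvgB; first exact: cvg_cst.
    by have := @cvg_harmonic R; rewrite -cvg_shiftS.
  have -> : (1 : R) = 1 * (1 * 1) * (1 + 0)^-1 by rewrite addr0 invr1 !mulr1.
  apply: cvgM; first exact: (cvgM r1 (cvgM r1 r1)).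
  apply: cvgV; first by rewrite addr0 oner_neq0.
  by apply: cvgD => //; exact: cvg_cst.
- rewrite /v mulrAC ler_pdivrMr// ler_wpM2l ?invr_ge0 ?exprn_ge0//.
  rewrite -[leLHS]/(q n ^+ n) -[X in _ ^+ X]card_ord -prodr_const.
  apply: ler_prod => i _; rewrite (ltW (q0 _))/= lerD2l lef_pV2 ?posrE//.
  by rewrite ler_nat ltnS; apply: kmono; exact: ltnW.
Qed.

Lemma sum_telescope_le1 (R : realType) N :
  \sum_(n < N) ((n.+1%:R * n.+2%:R)^-1 : R) <= 1.
Proof.
have -> : \sum_(n < N) ((n.+1%:R * n.+2%:R)^-1 : R) = 1 - N.+1%:R^-1.
  elim: N => [|N IH]; first by rewrite big_ord0 invr1 subrr.
  have : (N.+1%:R : R) != 0 by rewrite pnatr_eq0.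
  have : (N.+2%:R : R) != 0 by rewrite pnatr_eq0.
  rewrite big_ord_recr/= IH.
  have -> : (N.+1%:R : R) = N.+2%:R - 1 by rewrite -[N.+2]addn1 natrD addrK.
  by move: (N.+2%:R) => p p0 p1; field; rewrite p0 p1.
by rewrite gerBl invr_ge0.
Qed.

(** * From subexponential growth to a moderate function *)

Lemma finite_set_inj_lt (T : Type) (e : T -> nat) k :
  injective e -> finite_set [set x | (e x < k)%N].
Proof.
move=> einj; apply: (@finite_preimage T nat `I_k e _ (finite_II k)).
by move=> x y _ _; exact: einj.
Qed.

Lemma card_set_inj_lt (T : choiceType) (e : T -> nat) k :
  injective e -> (#|` fset_set [set x | (e x < k)%N]| <= k)%N.
Proof.
move=> einj; rewrite -[leqRHS](size_iota 0) -(size_map e).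
apply: uniq_leq_size; first by rewrite map_inj_uniq.
move=> _ /mapP[x xA ->]; move: xA; rewrite in_fset_set; last exact: finite_set_inj_lt.
by rewrite inE mem_iota.
Qed.

Lemma card_bigcup_le (R : realType) (I T : choiceType) (A : set I)
    (f : I -> set T) (M : R) :
  finite_set A -> (forall i, A i -> finite_set (f i)) ->
  (forall i, A i -> (#|` fset_set (f i)|)%:R <= M) ->
  (#|` fset_set (\bigcup_(i in A) f i)|)%:R <= (#|` fset_set A|)%:R * M.
Proof.
move=> Af ff fM.
pose s := flatten [seq enum_fset (fset_set (f i)) | i <- fset_set A].
apply: (@le_trans _ _ (size s)%:R).
  rewrite ler_nat; apply: uniq_leq_size => // x.
  rewrite in_fset_set; last exact: bigcup_finite.
  rewrite inE => -[i Ai fix_]; apply/flattenP; exists (enum_fset (fset_set (f i))).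
    by apply/mapP; exists i => //; rewrite in_fset_set// inE.
  by rewrite in_fset_set ?inE//; exact: ff.
rewrite size_flatten /shape -map_comp sumnE big_map natr_sum.
apply: (@le_trans _ _ (\sum_(i <- fset_set A) M)).
  rewrite big_seq [leRHS]big_seq; apply: ler_sum => i.
  by rewrite in_fset_set// inE; exact: fM.
by rewrite big_const_seq count_predT iter_addr_0 mulr_natl.
Qed.

Lemma countable_inj (T : Type) : countable [set: T] ->
  exists e : T -> nat, injective e.
Proof.
by move=> /countable_injP[e einj]; exists e => x y exy; apply: einj; rewrite ?inE.
Qed.

Lemma subexponential_moderate_l1 (R : realType) (G : groupType) (X : choiceType)
    (a : gset_action G X) (eG : G -> nat) (eX : X -> nat) :
  injective eG -> injective eX ->
  subexponential_orbits R a -> exists nu : X -> R, moderate_l1 a nu.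
Proof.
move=> Ginj Xinj sub.
(* The identity is put in S k so that S_k^n x increases with n. *)
pose S k := [set 1%g] `|` [set g | (eG g < k)%N].
pose F k := [set x | (eX x < k)%N].
have Sf k : finite_set (S k).
  by rewrite finite_setU; split; [exact: finite_set1|exact: finite_set_inj_lt].
have Ff k : finite_set (F k) by exact: finite_set_inj_lt.
have Smono m n : (m <= n)%N -> S m `<=` S n.
  by move=> mn g [->|gm]; [left|right; exact: leq_trans gm mn].
have Fmono m n : (m <= n)%N -> F m `<=` F n.
  by move=> mn x /= xm; exact: leq_trans xm mn.
pose P k n := forall x, F k x ->
  (#|` fset_set (set_orbit a (S k) n x)|)%:R <= (1 + k.+1%:R^-1 : R) ^+ n.
(* P 0 holds trivially, as F 0 is empty. *)
have [//|k|k [Pk kn kmono kinf]] := @diagonal_index P.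
  have S0 : S k !=set0 by exists 1%g; left.
  apply: (@filterS _ _ _ (\bigcap_(x in F k) [set n |
      (#|` fset_set (set_orbit a (S k) n x)|)%:R <= (1 + k.+1%:R^-1 : R) ^+ n])).
    by move=> n Pn x /Pn.
  rewrite -(fset_setK (Ff k)); apply: filter_bigI => x _.
  apply: (cvg_root_natP R (fun n => card_set_orbit_gt0 a n x (Sf k) S0)).1.
    exact: sub.
  by rewrite ltrDl invr_gt0.
have [v [v0 vlim vle]] := @slow_weight R k kmono kinf.
pose B n := \bigcup_(x in F (k n)) set_orbit a (S (k n)) n x.
have orbf n x : finite_set (set_orbit a (S (k n)) n x) by exact: finite_set_orbit.
have Bf n : finite_set (B n) by exact: bigcup_finite.
have BS n : B n `<=` B n.+1.
  move=> y [x xF yx]; exists x; first exact: Fmono (kmono _ _ (leqnSn n)) _ xF.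
  rewrite set_orbitS; exists 1%g; first by left.
  exists y; last by rewrite Defs.gact1.
  exact: sub_set_orbit (Smono _ _ (kmono _ _ (leqnSn n))) _ yx.
have cardB n : (#|` fset_set (B n)|)%:R <= n%:R * (1 + (k n).+1%:R^-1 : R) ^+ n.
  have q0 : 0 <= (1 + (k n).+1%:R^-1 : R) ^+ n by rewrite exprn_ge0// addr_ge0.
  apply: le_trans (card_bigcup_le (Ff _) (fun x _ => orbf n x) (Pk n)) _.
  rewrite ler_wpM2r// ler_nat; apply: leq_trans (kn n).
  exact: card_set_inj_lt.
apply: (@exhaustion_moderate_l1 R G X a B v 1) => //.
- apply: homo_leq => [A|A C D CA AD|//]; first exact: subset_refl.
  exact: subset_trans CA AD.
- move=> x; have [n nx] := kinf (eX x).+1; exists n; exists x => //.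
  move: (S (k n)) (or_introl erefl : S (k n) 1%g) => T T1.
  elim: n {nx} => [|n IH]; first by rewrite set_orbit0.
  by rewrite set_orbitS; exists 1%g => //; exists x => //; exact: Defs.gact1.
- move=> g; have [N Ng] := kinf (eG g).+1; exists N => n Nn y [x xF yx].
  exists x; first exact: Fmono (kmono _ _ (leqnSn n)) _ xF.
  rewrite set_orbitS; exists g.
    by right; apply: leq_trans Ng _; apply: kmono; exact: leqW.
  by exists y => //; exact: sub_set_orbit (Smono _ _ (kmono _ _ (leqnSn n))) _ yx.
- move=> N; apply: le_trans (sum_telescope_le1 R N); apply: ler_sum => i _.
  apply: le_trans (ler_wpM2l (ltW (v0 i)) (cardB i)) _.
  rewrite mulrCA; apply: le_trans (ler_wpM2l _ (vle i)) _ => //.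
  rewrite ler_pdivrMr ?exprn_gt0// mulrC ler_pdivlMr ?mulr_gt0//.
  by rewrite -natrX -!natrM ler_nat !expnS expn0; nia.
Qed.

Theorem proposition2p2 (R : realType) (G : groupType) (X : choiceType)
    (a : gset_action G X) :
  countable [set: G] -> countable [set: X] ->
  (exists nu : X -> R, moderate_l1 a nu) <-> subexponential_orbits R a.
Proof.
move=> /countable_inj[eG Ginj] /countable_inj[eX Xinj]; split=> [[nu]|].
  exact: moderate_l1_subexponential.
exact: subexponential_moderate_l1 Ginj Xinj.
Qed.
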